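(* Let $d\ge 2$ be an integer, let $V=\{1,\dots,d\}$, and let $\Pi=(\pi_{ij})$ be a real $d\times d$ matrix such that: $\pi_{ii}=1$ for all $i\in V$; $\pi_{ij}>0$ for all $i,j\in V$; $\pi_{ij}\le \pi_{ik}\pi_{kj}$ for all $i,j,k\in V$; and there exist $i,j,k\in V$ with $\pi_{ij}<\pi_{ik}\pi_{kj}$. Assume that also $\pi_{ij}<\pi_{ik}\pi_{kj}$ for all $i,j\in V$ and all $k\in V\setminus\{i,j\}$. Let $x,y\in\mathbb{R}^d$ be two feasible tree solutions with respect to bipartitions $(P_x,N_x)$ and $(P_y,N_y)$ of $V$, respectively. Then $(P_x,N_x)\ne(P_y,N_y)$ implies $x\ne\alpha y$ for all $\alpha>0$. Moreover, $K_d^+$, the dual cone of the solvency cone $K_d$ induced by $\Pi$, has at least $2^d-2$ extreme directions.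
   Context: The solvency cone is $K_d=\{\sum_{(i,j)\in V\times V} z_{ij}(\pi_{ij}e^i-e^j) : z_{ij}\ge 0 \text{ for all } i,j\}$, where $e^i$ is the $i$-th unit vector of $\mathbb{R}^d$, and $K_d^+=\{y\in\mathbb{R}^d : x^\top y\ge 0 \text{ for all } x\in K_d\}$. A vector $y\in K\setminus\{0\}$ is an extreme direction of a polyhedral convex cone $K$ if it belongs to a $1$-dimensional face of $K$; extreme directions that are positive multiples of each other are considered identical (and counted once). A bipartition $(P,N)$ of $V$ is an ordered pair of nonempty disjoint sets with $P\cup N=V$. $G(P,N)$ is the bipartite digraph with node set $V$ and arc set $P\times N$. A spanning tree of a digraph is a connected subgraph with the full node set and without cycles, where arc directions are ignored for connectedness and cycles. A vector $y\in\mathbb{R}^d$ is generated by a tree $T$ if $T$ is a spanning tree of $G(P,N)$ and $\pi_{ij}y_i=y_j>0$ for all arcs $(i,j)\in E(T)\subseteq P\times N$. A vector $y$ is feasible with respect to $(P,N)$ if $\pi_{ij}y_i\ge y_j>0$ for all $(i,j)\in P\times N$. A feasible tree solution with respect to $(P,N)$ is a vector $y\in\mathbb{R}^d$ that is both feasible with respect to $(P,N)$ and generated by some spanning tree of $G(P,N)$. *)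

(* Defs.v *)
(* MathComp / MathComp-Analysis; the real numbers are an arbitrary realType. *)
From HB Require Import structures.
From mathcomp Require Export all_boot all_order all_algebra.
From mathcomp Require Export boolp classical_sets functions cardinality reals.
From mathcomp Require Export convex.

Set Implicit Arguments.
Unset Strict Implicit.
Unset Printing Implicit Defensive.

Import Order.TTheory GRing.Theory Num.Theory.

Definition is_bipartition (V : finType) (PN : {set V} * {set V}) : Prop :=
  [/\ PN.1 != finset.set0, PN.2 != finset.set0, [disjoint PN.1 & PN.2]
    & PN.1 :|: PN.2 = [set: V]].

(* Digraphs with node set V are given by their arc sets, so that a subgraph with
   full node set is a subset of arcs. *)
Definition bip_digraph (V : finType) (PN : {set V} * {set V}) : {set V * V} :=
  finset.setX PN.1 PN.2.

Definition undirected (V : finType) (T : {set V * V}) : rel V :=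
  [rel i j | ((i, j) \in T) || ((j, i) \in T)].

Definition graph_connected (V : finType) (T : {set V * V}) : Prop :=
  forall i j : V, connect (undirected T) i j.

(* The first clause excludes the cycles of length 1 (loops) and 2 (a pair of
   opposite arcs), the second one those of length at least 3. *)
Definition graph_acyclic (V : finType) (T : {set V * V}) : Prop :=
  (forall i j : V, (i, j) \in T -> (j, i) \notin T) /\
  (forall c : seq V, (2 < size c)%N -> ~ ucycle (undirected T) c).

Definition spanning_tree (V : finType) (E T : {set V * V}) : Prop :=
  [/\ T \subset E, graph_connected T & graph_acyclic T].

Local Open Scope classical_set_scope.
Local Open Scope ring_scope.

Definition unit_vec (R : realType) (d : nat) (i : 'I_d) : 'cV[R]_d :=
  delta_mx i 0.

Definition solvency_cone (R : realType) (d : nat) (Pi : 'M[R]_d) :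
    set 'cV[R]_d :=
  [set x | exists z : 'M[R]_d, (forall i j, 0 <= z i j) /\
     x = \sum_i \sum_j z i j *: (Pi i j *: unit_vec R i - unit_vec R j)].

Definition dual_cone (R : realType) (d : nat) (K : set 'cV[R]_d) :
    set 'cV[R]_d :=
  [set y | forall x, K x -> 0 <= (x^T *m y) 0 0].

(* A convex subset F of C such that every segment in C having a relative
   interior point in F has both endpoints in F. *)
Definition is_face (R : realType) (d : nat) (C F : set 'cV[R]_d) : Prop :=
  [/\ F `<=` C,
      convex_set F
    & forall (x y : 'cV[R]_d) (t : R), C x -> C y -> 0 < t -> t < 1 ->
        F (t *: x + (1 - t) *: y) -> F x /\ F y].

(* F is nonempty and its affine hull x0 + U has direction space U of
   dimension k: U is the least subspace containing F - x0. *)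
Definition has_dim (R : realType) (d : nat) (F : set 'cV[R]_d) (k : nat) :
    Prop :=
  exists x0 : 'cV[R]_d, F x0 /\
  exists U : {vspace 'cV[R]_d},
    [/\ \dim U = k,
        forall x, F x -> x - x0 \in U
      & forall W : {vspace 'cV[R]_d},
          (forall x, F x -> x - x0 \in W) -> (U <= W)%VS].

Definition extreme_direction (R : realType) (d : nat) (K : set 'cV[R]_d)
    (y : 'cV[R]_d) : Prop :=
  [/\ K y, y != 0 & exists F, [/\ is_face K F, has_dim F 1 & F y]].

Definition open_ray (R : realType) (d : nat) (y : 'cV[R]_d) : set 'cV[R]_d :=
  [set x | exists2 a : R, 0 < a & x = a *: y].

(* Extreme directions up to positive multiples: each one is represented by the
   set of its positive multiples. *)
Definition extreme_directions (R : realType) (d : nat) (K : set 'cV[R]_d) :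
    set (set 'cV[R]_d) :=
  [set open_ray y | y in [set y | extreme_direction K y]].

Definition generated_by (R : realType) (d : nat) (Pi : 'M[R]_d)
    (PN : {set 'I_d} * {set 'I_d}) (T : {set 'I_d * 'I_d}) (y : 'cV[R]_d) :
    Prop :=
  spanning_tree (bip_digraph PN) T /\
  (forall i j, (i, j) \in T -> Pi i j * y i 0 = y j 0 /\ 0 < y j 0).

Definition feasible (R : realType) (d : nat) (Pi : 'M[R]_d)
    (PN : {set 'I_d} * {set 'I_d}) (y : 'cV[R]_d) : Prop :=
  forall i j, i \in PN.1 -> j \in PN.2 ->
    y j 0 <= Pi i j * y i 0 /\ 0 < y j 0.

Definition feasible_tree_solution (R : realType) (d : nat) (Pi : 'M[R]_d)
    (PN : {set 'I_d} * {set 'I_d}) (y : 'cV[R]_d) : Prop :=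
  feasible Pi PN y /\ exists T, generated_by Pi PN T y.

(* Main.v *)
Require Import Defs.
From mathcomp Require Import lra.

(** Writing out the generators of K_d shows that y lies in the dual cone exactly
    when y_j <= pi_ij y_i for all i, j.  So everything is read off from the
    bipartite graph of the tight arcs of y in P x N, those with
    pi_ij y_i = y_j.  If y is a feasible tree solution, its tight arcs contain
    a spanning tree and hence connect V.

    This connectedness has three consequences.  Every node has a tight arc, and
    the triangle inequality then extends feasibility from P x N to all pairs:
    y lies in the dual cone ([tight_connected_dual]).  The bipartition
    can be recovered from y: if a node v were in P for one bipartition and in N for another,
    tight arcs i -> v -> j would give y_j = pi_iv pi_vj y_i > pi_ij y_i, which
    contradicts membership in the dual cone
    ([tight_connected_same_bipartition]); this is the first claim.  Finally, the
    tight arcs determine y up to a scalar, and both summands of a decomposition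
    of y inside the dual cone must be tight wherever y is, so the ray of y is a
    face ([tight_connected_extreme]).

    The lower bound then needs one such y for each of the 2^d - 2 bipartitions
    ([exists_tight_connected]).  Start from any feasible vector; while its tight
    arcs leave a proper union S of components, some arc of P x N crosses the
    boundary of S, and rescaling y on S (or on its complement) until a first
    crossing arc becomes tight keeps all the old tight arcs and gains a new one
    ([rescale_gains_tight_arc]). *)

Set Implicit Arguments.
Unset Strict Implicit.
Unset Printing Implicit Defensive.

Import Order.TTheory GRing.Theory Num.Theory.
Local Open Scope ring_scope.

(** * Vectors whose tight arcs connect all nodes *)

Definition tight_arcs (R : realType) (d : nat) (Pi : 'M[R]_d)
    (PN : {set 'I_d} * {set 'I_d}) (y : 'cV[R]_d) : {set 'I_d * 'I_d} :=
  [set a in bip_digraph PN | Pi a.1 a.2 * y a.1 0 == y a.2 0].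

(** The common ground between the feasible tree solutions and the vectors built
    by rescaling: a connected set of tight arcs pins [y] down up to a scalar. *)
Definition tight_connected (R : realType) (d : nat) (Pi : 'M[R]_d)
    (PN : {set 'I_d} * {set 'I_d}) (y : 'cV[R]_d) : Prop :=
  feasible Pi PN y /\ graph_connected (tight_arcs Pi PN y).

Lemma tight_arcsP (R : realType) (d : nat) (Pi : 'M[R]_d)
    (PN : {set 'I_d} * {set 'I_d}) (y : 'cV[R]_d) i j :
  reflect [/\ i \in PN.1, j \in PN.2 & Pi i j * y i 0 = y j 0]
          ((i, j) \in tight_arcs Pi PN y).
Proof.
rewrite inE /bip_digraph finset.in_setX /=.
by apply: (iffP idP) => [/andP[/andP[-> ->] /eqP]|[-> -> ->]] //=.
Qed.

Lemma feasible_tree_tight_connected (R : realType) (d : nat) (Pi : 'M[R]_d)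
    (PN : {set 'I_d} * {set 'I_d}) (y : 'cV[R]_d) :
  feasible_tree_solution Pi PN y -> tight_connected Pi PN y.
Proof.
move=> [fy [T [[/fintype.subsetP TG Tconn _] yT]]]; split=> // i j.
apply: connect_sub (Tconn i j) => a b.
have Ttight e : e \in T -> e \in tight_arcs Pi PN y.
  case: e => e1 e2 eT; have := TG _ eT.
  rewrite finset.in_setX => /andP[e1P e2N].
  by apply/tight_arcsP; split=> //; case: (yT _ _ eT).
by move=> /orP[] /Ttight ab; apply: connect1; apply/orP; [left|right].
Qed.

Lemma bipartition_other_side (V : finType) (PN : {set V} * {set V}) v :
  is_bipartition PN -> (v \notin PN.1) = (v \in PN.2).
Proof.
move=> [_ _ /pred0P dis cov].
have := finset.in_setT v; rewrite -cov inE; have /= := dis v.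
by case: (v \in PN.1); case: (v \in PN.2).
Qed.

Lemma bipartition_proper (V : finType) (PN : {set V} * {set V}) :
  is_bipartition PN -> (exists p, p \in PN.1) /\ (exists n, n \in PN.2).
Proof. by move=> [/set0Pn ? /set0Pn ? _ _]. Qed.

Lemma feasible_gt0 (R : realType) (d : nat) (Pi : 'M[R]_d)
    (PN : {set 'I_d} * {set 'I_d}) (y : 'cV[R]_d) v :
  (forall i j, 0 < Pi i j) -> is_bipartition PN -> feasible Pi PN y ->
  0 < y v 0.
Proof.
move=> Pi_gt0 bPN fy; have [[p pP] [n nN]] := bipartition_proper bPN.
have := bipartition_other_side v bPN; case: (boolP (v \in PN.1)) => vP /= vN.
  have [le_n n_gt0] := fy _ _ vP nN.
  by rewrite -(pmulr_rgt0 _ (Pi_gt0 v n)); apply: lt_le_trans le_n.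
by have [] := fy _ _ pP (esym vN).
Qed.

Lemma connect_neighbour (V : finType) (e : rel V) x y :
  connect e x y -> x != y -> exists z, e x z.
Proof.
move=> /connectP[[|z s] /= + ->]; first by rewrite eqxx.
by move=> /andP[exz _] _; exists z.
Qed.

Lemma tight_out (R : realType) (d : nat) (Pi : 'M[R]_d)
    (PN : {set 'I_d} * {set 'I_d}) (y : 'cV[R]_d) p :
  is_bipartition PN -> tight_connected Pi PN y -> p \in PN.1 ->
  exists2 n, n \in PN.2 & Pi p n * y p 0 = y n 0.
Proof.
move=> bPN [_ conn] pP; have [_ [n nN]] := bipartition_proper bPN.
have pn : p != n.
  by apply: contraTneq pP => ->; rewrite -(bipartition_other_side n bPN) in nN.
have [z /orP[/tight_arcsP[_ zN eq]|/tight_arcsP[_ pN _]]] :=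
  connect_neighbour (conn p n) pn; first by exists z.
by rewrite -(bipartition_other_side p bPN) pP in pN.
Qed.

Lemma tight_in (R : realType) (d : nat) (Pi : 'M[R]_d)
    (PN : {set 'I_d} * {set 'I_d}) (y : 'cV[R]_d) n :
  is_bipartition PN -> tight_connected Pi PN y -> n \in PN.2 ->
  exists2 p, p \in PN.1 & Pi p n * y p 0 = y n 0.
Proof.
move=> bPN [_ conn] nN; have [[p pP] _] := bipartition_proper bPN.
have np : n != p.
  by apply: contraTneq nN => ->; rewrite -(bipartition_other_side p bPN) pP.
have [z /orP[/tight_arcsP[nP _ _]|/tight_arcsP[zP _ eq]]] :=
  connect_neighbour (conn n p) np; last by exists z.
by rewrite -(bipartition_other_side n bPN) nP in nN.
Qed.

(** * Membership in the dual cone and recovery of the bipartition *)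

(** Tight arcs propagate the inequalities on P x N to all pairs.  For two nodes
    p, k of P, compare both with the end n of a tight arc leaving k; for i in N,
    start from the origin of a tight arc entering i. *)
Lemma tight_connected_dual (R : realType) (d : nat) (Pi : 'M[R]_d)
    (PN : {set 'I_d} * {set 'I_d}) (y : 'cV[R]_d) i j :
  (forall i j, 0 < Pi i j) ->
  (forall i j k, Pi i j <= Pi i k * Pi k j) ->
  is_bipartition PN -> tight_connected Pi PN y -> y j 0 <= Pi i j * y i 0.
Proof.
move=> Pi_gt0 Pi_le bPN ty; have fy := ty.1.
have y_gt0 v := feasible_gt0 v Pi_gt0 bPN fy.
have from_P p k : p \in PN.1 -> y k 0 <= Pi p k * y p 0.
  move=> pP; have := bipartition_other_side k bPN.
  case: (boolP (k \in PN.1)) => kP /= kN; last first.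
    by have [] := fy _ _ pP (esym kN).
  have [n nN eq_n] := tight_out bPN ty kP.
  rewrite -(ler_pM2l (Pi_gt0 k n)) eq_n.
  have [le_n _] := fy _ _ pP nN; apply: le_trans le_n _.
  by rewrite mulrA (mulrC (Pi k n)) ler_wpM2r // ltW.
have := bipartition_other_side i bPN.
case: (boolP (i \in PN.1)) => iP /= iN; first exact: from_P.
have [p pP <-] := tight_in bPN ty (esym iN).
apply: le_trans (from_P p j pP) _.
by rewrite mulrA (mulrC (Pi i j)) ler_wpM2r // ltW.
Qed.

(** A node v in P for one bipartition and in N for the other is the middle of
    two consecutive tight arcs p -> v -> n; by the strict triangle inequality
    the inequality of the dual cone fails for the pair (p, n), also when
    p = n. *)
Lemma tight_connected_same_bipartition (R : realType) (d : nat) (Pi : 'M[R]_d)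
    (y : 'cV[R]_d) (PN PN' : {set 'I_d} * {set 'I_d}) :
  (forall i j, 0 < Pi i j) ->
  (forall i j k, Pi i j <= Pi i k * Pi k j) ->
  (forall i j k : 'I_d, k != i -> k != j -> Pi i j < Pi i k * Pi k j) ->
  is_bipartition PN -> is_bipartition PN' ->
  tight_connected Pi PN y -> tight_connected Pi PN' y -> PN = PN'.
Proof.
move=> Pi_gt0 Pi_le Pi_lt.
have sub A B v : is_bipartition A -> is_bipartition B ->
    tight_connected Pi A y -> tight_connected Pi B y -> v \in A.1 -> v \in B.1.
  move=> bA bB tA tB vA; apply: contraT => vB.
  have [n nA eq_n] := tight_out bA tA vA.
  rewrite (bipartition_other_side v bB) in vB.
  have [p pB eq_p] := tight_in bB tB vB.
  have vp : v != p.
    by apply: contraTneq pB => <-; rewrite (bipartition_other_side v bB).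
  have vn : v != n.
    by apply: contraTneq nA => <-; rewrite -(bipartition_other_side v bA) vA.
  have := tight_connected_dual p n Pi_gt0 Pi_le bA tA.
  rewrite -eq_n -eq_p mulrA ler_pM2r ?(feasible_gt0 p Pi_gt0 bA tA.1) //.
  by rewrite mulrC leNgt Pi_lt.
move=> bA bB tA tB.
have eq1 : PN.1 = PN'.1 by apply/setP => v; apply/idP/idP; apply: sub.
have eq2 : PN.2 = PN'.2.
  by apply/setP => v; rewrite -!bipartition_other_side // eq1.
by case: PN eq1 eq2 {bA tA} => a b /= -> ->; case: PN' {bB tB}.
Qed.

Lemma tight_connected_scale (R : realType) (d : nat) (Pi : 'M[R]_d)
    (PN : {set 'I_d} * {set 'I_d}) (y : 'cV[R]_d) a :
  0 < a -> tight_connected Pi PN y -> tight_connected Pi PN (a *: y).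
Proof.
move=> a_gt0 [fy conn]; split=> [i j iP jN|].
  have [le_j j_gt0] := fy _ _ iP jN.
  by rewrite !mxE mulrCA ler_pM2l // mulr_gt0.
suff -> : tight_arcs Pi PN (a *: y) = tight_arcs Pi PN y by [].
apply/setP => e; rewrite !inE !mxE mulrCA.
by rewrite (inj_eq (mulfI (lt0r_neq0 a_gt0))).
Qed.

(** * Existence for every bipartition *)

Lemma exists_feasible (R : realType) (d : nat) (Pi : 'M[R]_d)
    (PN : {set 'I_d} * {set 'I_d}) :
  (forall i j, 0 < Pi i j) -> is_bipartition PN ->
  exists y, feasible Pi PN y.
Proof.
move=> Pi_gt0 bPN.
(* On P, the sum of the inverses dominates each (Pi i j)^-1. *)
exists (\col_i (if i \in PN.1 then \sum_k (Pi i k)^-1 else 1)) => i j iP jN.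
rewrite !mxE iP.
have /negPf-> : j \notin PN.1 by rewrite bipartition_other_side.
split=> //; rewrite (bigD1 j) //= mulrDr mulfV ?lt0r_neq0 // lerDl.
by rewrite mulr_ge0 ?sumr_ge0 ?ltW // => k _; rewrite invr_ge0 ltW.
Qed.

(** Multiply [y] on [S] by the least ratio pi_ab y_a / y_b over the arcs of
    P x N entering [S]; feasibility makes it at least 1.  Arcs on one side of
    [S] are unaffected, arcs leaving [S] only gain slack, and the minimising
    arc becomes tight. *)
Lemma rescale_gains_tight_arc (R : realType) (d : nat) (Pi : 'M[R]_d)
    (PN : {set 'I_d} * {set 'I_d}) (y : 'cV[R]_d) (S : {set 'I_d}) i j :
  (forall i j, 0 < Pi i j) -> is_bipartition PN -> feasible Pi PN y ->
  (forall a b, (a, b) \in tight_arcs Pi PN y -> (a \in S) = (b \in S)) ->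
  i \in PN.1 -> i \notin S -> j \in PN.2 -> j \in S ->
  exists y', feasible Pi PN y' /\
             tight_arcs Pi PN y \proper tight_arcs Pi PN y'.
Proof.
move=> Pi_gt0 bPN fy closedS iP iS jN jS.
have y_gt0 v := feasible_gt0 v Pi_gt0 bPN fy.
pose entering := [pred a : 'I_d * 'I_d |
  [&& a.1 \in PN.1, a.1 \notin S, a.2 \in PN.2 & a.2 \in S]].
pose ratio (a : 'I_d * 'I_d) := Pi a.1 a.2 * y a.1 0 / y a.2 0.
have ij_enters : entering (i, j) by rewrite /= iP iS jN jS.
case: (arg_minP ratio ij_enters) => -[p n] /and4P[/= pP pS nN nS] min_pn.
pose t := ratio (p, n).
have t_ge1 : 1 <= t.
  by rewrite ler_pdivlMr // mul1r; have [] := fy _ _ pP nN.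
have t_gt0 : 0 < t by apply: lt_le_trans t_ge1.
pose y' : 'cV[R]_d := \col_k (if k \in S then t * y k 0 else y k 0).
exists y'; split.
  move=> a b aP bN; have [le_b b_gt0] := fy _ _ aP bN; rewrite !mxE.
  case: (boolP (a \in S)) => aS; case: (boolP (b \in S)) => bS; split=> //.
  - by rewrite mulrCA ler_pM2l.
  - by rewrite mulr_gt0.
  - apply: le_trans le_b _; rewrite mulrCA ler_peMl //.
    by rewrite mulr_ge0 // ltW.
  - by rewrite -ler_pdivlMr //; apply: (min_pn (a, b)); rewrite /= aP aS bN bS.
  - by rewrite mulr_gt0.
apply/properP; split.
  apply/fintype.subsetP => -[a b] ab; apply/tight_arcsP.
  have eq_side := closedS _ _ ab; have /tight_arcsP[aP bN eq] := ab.
  split=> //; rewrite !mxE eq_side; case: ifP => // _.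
  by rewrite mulrCA eq.
exists (p, n); last by apply: contra pS => /closedS ->.
apply/tight_arcsP; split=> //; rewrite !mxE (negPf pS) nS /t /ratio /=.
by rewrite divfK // lt0r_neq0.
Qed.

(** Induction on the number of arcs that are not tight.  If the tight arcs do
    not connect V, let S be a component: since P and N are nonempty, some arc of
    P x N has its ends on different sides of S, and it enters either S or the
    complement of S. *)
Lemma exists_tight_connected (R : realType) (d : nat) (Pi : 'M[R]_d)
    (PN : {set 'I_d} * {set 'I_d}) :
  (forall i j, 0 < Pi i j) -> is_bipartition PN ->
  exists y, tight_connected Pi PN y.
Proof.
move=> Pi_gt0 bPN; have [y fy] := exists_feasible Pi_gt0 bPN.
have [m] := ubnP #|~: tight_arcs Pi PN y|.
elim: m y fy => // m IH y fy lt_m.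
pose e := undirected (tight_arcs Pi PN y).
have [/forallP conn|] := boolP [forall i, forall j, connect e i j].
  by exists y; split=> // i j; apply/forallP/conn.
rewrite negb_forall => /existsP[i]; rewrite negb_forall => /existsP[j ij].
suff [y' [fy' lt_y]] : exists y', feasible Pi PN y' /\
    tight_arcs Pi PN y \proper tight_arcs Pi PN y'.
  have lt_c : (#|~: tight_arcs Pi PN y'| < #|~: tight_arcs Pi PN y|)%N.
    by apply: fintype.proper_card; rewrite finset.properC.
  by apply: (IH y' fy'); rewrite ltnS in lt_m; exact: (leq_trans lt_c lt_m).
pose S := [set k | connect e i k].
have closedS a b : (a, b) \in tight_arcs Pi PN y -> (a \in S) = (b \in S).
  move=> ab; rewrite !inE; apply/idP/idP => /connect_trans; apply.
    by apply: connect1; apply/orP; left.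
  by apply: connect1; apply/orP; right.
case: (pickP [pred a : 'I_d * 'I_d |
    [&& a.1 \in PN.1, a.2 \in PN.2 & (a.1 \in S) != (a.2 \in S)]]).
  move=> [p n] /= /and3P[pP nN].
  case: (boolP (p \in S)) => pS; case: (boolP (n \in S)) => nS // _.
    apply: (@rescale_gains_tight_arc _ _ _ _ _ (~: S) p n);
      rewrite ?finset.in_setC ?negbK //.
    by move=> a b ab; rewrite !finset.in_setC (closedS a b).
  by apply: (@rescale_gains_tight_arc _ _ _ _ _ S p n).
move=> no_crossing; have [[p pP] [n nN]] := bipartition_proper bPN.
have same a b : a \in PN.1 -> b \in PN.2 -> (a \in S) = (b \in S).
  move=> aP bN; have /= := no_crossing (a, b).
  by rewrite aP bN /= => /negbFE/eqP.
have all_p v : (v \in S) = (p \in S).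
  have := bipartition_other_side v bPN.
  case: (boolP (v \in PN.1)) => vP /= vN; last by rewrite (same p v).
  by rewrite (same v n) // (same p n).
have : (i \in S) = (j \in S) by rewrite !all_p.
by rewrite !inE connect0 (negPf ij).
Qed.

(** * Extremality *)

(** The nodes w with u_w / y_w = u_v / y_v form a set closed under tight
    arcs that contains v; by connectedness it contains every node. *)
Lemma tight_collinear (R : realType) (d : nat) (Pi : 'M[R]_d)
    (PN : {set 'I_d} * {set 'I_d}) (y u : 'cV[R]_d) v :
  (forall i j, 0 < Pi i j) -> is_bipartition PN -> tight_connected Pi PN y ->
  (forall i j, (i, j) \in tight_arcs Pi PN y -> Pi i j * u i 0 = u j 0) ->
  u = (u v 0 / y v 0) *: y.
Proof.
move=> Pi_gt0 bPN [fy conn] tight_u.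
have y_gt0 w := feasible_gt0 w Pi_gt0 bPN fy.
pose A := [set w | u w 0 * y v 0 == u v 0 * y w 0].
have arc a b : (a, b) \in tight_arcs Pi PN y -> (a \in A) = (b \in A).
  move=> ab; have /tight_arcsP[_ _ eq] := ab.
  rewrite !inE -eq -(tight_u a b ab) -mulrA [u v 0 * (_ * _)]mulrCA.
  by rewrite (inj_eq (mulfI (lt0r_neq0 (Pi_gt0 a b)))).
have closedA : closed (undirected (tight_arcs Pi PN y)) A.
  by move=> a b /orP[/arc|/arc/esym].
apply/matrixP => w k; rewrite !mxE (ord1 k).
have := closed_connect closedA (conn v w); rewrite !inE eqxx => /esym/eqP eq.
by rewrite mulrAC -eq mulfK // lt0r_neq0.
Qed.

Local Open Scope classical_set_scope.
Local Open Scope card_scope.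

Lemma dual_coneP (R : realType) (d : nat) (Pi : 'M[R]_d) (y : 'cV[R]_d) :
  dual_cone (solvency_cone Pi) y <->
  forall i j, y j 0 <= Pi i j * y i 0.
Proof.
have generator i j (c : R) :
    ((c *: (Pi i j *: unit_vec R i - unit_vec R j))^T *m y) 0 0 =
    c * (Pi i j * y i 0 - y j 0).
  rewrite /unit_vec linearZ /= linearB /= linearZ /= !trmx_delta.
  by rewrite -scalemxAl mulmxBl -scalemxAl -!rowE !mxE.
split=> [Ky i j|le_y x [z [z_ge0 ->]]].
  rewrite -subr_ge0 -[X in 0 <= X]mul1r -generator; apply: Ky.
  exists (delta_mx i j); split=> [a b|]; first by rewrite mxE ler0n.
  rewrite (bigD1 i) //= (bigD1 j) //= mxE !eqxx !big1 ?addr0 //.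
    by move=> a /negPf ai; rewrite big1 // => b _; rewrite mxE ai scale0r.
  by move=> b /negPf bj; rewrite mxE bj andbF scale0r.
rewrite linear_sum /= mulmx_suml summxE sumr_ge0 // => i _.
rewrite linear_sum /= mulmx_suml summxE sumr_ge0 // => j _.
by rewrite generator mulr_ge0 // subr_ge0.
Qed.

Definition closed_ray (R : realType) (d : nat) (y : 'cV[R]_d) : set 'cV[R]_d :=
  [set x | exists2 c : R, 0 <= c & x = c *: y].

Lemma closed_ray_dim1 (R : realType) (d : nat) (y : 'cV[R]_d) :
  y != 0 -> has_dim (closed_ray y) 1.
Proof.
move=> y0; exists 0; split; first by exists 0; rewrite ?scale0r.
exists <[y]>%VS; split=> [|x [c _ ->]|W subW].
- by rewrite dim_vline y0.
- by rewrite subr0 memvZ // memv_line.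
- by rewrite -memvE -[y]subr0; apply: subW; exists 1; rewrite ?scale1r.
Qed.

Lemma closed_ray_convex (R : realType) (d : nat) (y : 'cV[R]_d) :
  convex_set (closed_ray y).
Proof.
apply/convex_setW => _ _ /set_mem[b b_ge0 ->] /set_mem[c c_ge0 ->] k.
move=> k_gt0 k_lt1.
apply/mem_set.
exists (interval_inference.Itv.r k * b + (1 - interval_inference.Itv.r k) * c).
  by rewrite addr_ge0 // mulr_ge0 // ?subr_ge0 ltW.
by rewrite scalerDl -!scalerA.
Qed.

(** A round trip i -> j -> i in the dual cone gives y_i <= pi_ij pi_ji y_i with
    a factor above 1. *)
Lemma dual_cone_ge0 (R : realType) (d : nat) (Pi : 'M[R]_d) (y : 'cV[R]_d) i j :
  (forall i j, 0 < Pi i j) -> 1 < Pi i j * Pi j i ->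
  dual_cone (solvency_cone Pi) y -> 0 <= y i 0.
Proof.
move=> Pi_gt0 gain /dual_coneP le_y.
have le_i : y i 0 <= Pi i j * Pi j i * y i 0.
  apply: le_trans (le_y j i) _.
  by rewrite [Pi i j * _]mulrC -mulrA ler_pM2l.
have factor_gt0 : 0 < Pi i j * Pi j i - 1 by rewrite subr_gt0.
by rewrite -(pmulr_rge0 _ factor_gt0) mulrBl mul1r subr_ge0.
Qed.

(** The face is the closed ray of [y].  If s u + (1 - s) w is on that ray with
    u, w in the dual cone, the slacks of u and w on a tight arc of [y] are
    nonnegative with a positive combination equal to 0, so u is tight there and
    therefore a multiple of [y]. *)
Lemma tight_connected_extreme (R : realType) (d : nat) (Pi : 'M[R]_d)
    (PN : {set 'I_d} * {set 'I_d}) (y : 'cV[R]_d) :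
  (forall i j, 0 < Pi i j) ->
  (forall i j k, Pi i j <= Pi i k * Pi k j) ->
  (forall i j, i != j -> 1 < Pi i j * Pi j i) ->
  is_bipartition PN -> tight_connected Pi PN y ->
  extreme_direction (dual_cone (solvency_cone Pi)) y.
Proof.
move=> Pi_gt0 Pi_le gain bPN ty.
have y_gt0 v := feasible_gt0 v Pi_gt0 bPN ty.1.
have [[p pP] [n nN]] := bipartition_proper bPN.
have pn : p != n.
  by apply: contraTneq pP => ->; rewrite -(bipartition_other_side n bPN) in nN.
have Ky : dual_cone (solvency_cone Pi) y.
  by apply/dual_coneP => i j; apply: tight_connected_dual bPN ty.
have y0 : y != 0.
  by apply: contraTneq (y_gt0 p) => ->; rewrite mxE ltxx.
split=> //; exists (closed_ray y); split; last by exists 1; rewrite ?scale1r.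
  split.
  - move=> _ [c c_ge0 ->]; apply/dual_coneP => i j; rewrite !mxE mulrCA.
    by apply: ler_wpM2l => //; apply: tight_connected_dual bPN ty.
  - exact: closed_ray_convex.
  - move=> u w t Ku Kw t_gt0 t_lt1 [c c_ge0 eq_c].
    suff on_ray (u' w' : 'cV[R]_d) s : dual_cone (solvency_cone Pi) u' ->
        dual_cone (solvency_cone Pi) w' -> 0 < s -> s < 1 ->
        s *: u' + (1 - s) *: w' = c *: y -> closed_ray y u'.
      split; first exact: (on_ray u w t).
      apply: (on_ray w u (1 - t)) => //; rewrite ?subr_gt0 ?gtrBl //.
      by rewrite subKr addrC.
    move=> {u w t Ku Kw t_gt0 t_lt1 eq_c} Ku Kw s_gt0 s_lt1 eq_c.
    exists (u' p 0 / y p 0).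
      rewrite divr_ge0 ?(ltW (y_gt0 p)) //.
      exact: dual_cone_ge0 (gain _ _ pn) Ku.
    apply: tight_collinear bPN ty _ => // i j /tight_arcsP[iP jN eq_y].
    have le_u := (dual_coneP _ _).1 Ku i j.
    have le_w := (dual_coneP _ _).1 Kw i j.
    have := congr1 (fun x : 'cV_d => Pi i j * x i 0 - x j 0) eq_c.
    rewrite !mxE -eq_y => eq_slack.
    have s1_gt0 : 0 < 1 - s by rewrite subr_gt0.
    apply/eqP; rewrite eq_le le_u andbT -(ler_pM2l s_gt0).
    have := ler_wpM2l (ltW s1_gt0) le_w.
    lra.
exact: closed_ray_dim1.
Qed.

(** * Counting bipartitions *)

Lemma bipartition_of_set (V : finType) (P : {set V}) :
  P \in ~: [set finset.set0; finset.setT]%SET -> is_bipartition (P, ~: P)%SET.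
Proof.
rewrite !inE negb_or => /andP[P0 PT]; split=> //=.
- by apply: contra PT => /eqP PC0; rewrite -[P]finset.setCK PC0 finset.setC0.
- by rewrite finset.disjoints_subset finset.setCK.
- exact: finset.setUCr.
Qed.

Lemma card_proper_sets (d : nat) :
  (2 <= d)%N ->
  #|~: [set finset.set0; finset.setT : {set 'I_d}]%SET| = (2 ^ d - 2)%N.
Proof.
move=> d2; rewrite cardsCs finset.setCK cards2 -cardsT -powersetT card_powerset.
rewrite cardsT card_ord.
suff -> : finset.set0 != finset.setT :> {set 'I_d} by [].
rewrite eq_sym; apply/set0Pn.
by exists (Ordinal (ltnW d2)).
Qed.

Theorem corollary12 (R : realType) (d : nat) (Pi : 'M[R]_d)
  (hd : (2 <= d)%N)
  (Pi_diag : forall i, Pi i i = 1)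
  (Pi_gt0 : forall i j, 0 < Pi i j)
  (Pi_le : forall i j k, Pi i j <= Pi i k * Pi k j)
  (Pi_ex_lt : exists i j k, Pi i j < Pi i k * Pi k j)
  (Pi_lt : forall i j k : 'I_d, k != i -> k != j -> Pi i j < Pi i k * Pi k j) :
  (forall (x y : 'cV[R]_d) (PNx PNy : {set 'I_d} * {set 'I_d}),
     is_bipartition PNx -> is_bipartition PNy ->
     feasible_tree_solution Pi PNx x -> feasible_tree_solution Pi PNy y ->
     PNx <> PNy ->
     forall a : R, 0 < a -> x <> a *: y) /\
  `I_(2 ^ d - 2)%N #<= extreme_directions (dual_cone (solvency_cone Pi)).
Proof.
have distinct (x y : 'cV[R]_d) PNx PNy a : is_bipartition PNx ->
    is_bipartition PNy ->
    tight_connected Pi PNx x -> tight_connected Pi PNy y ->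
    0 < a -> x = a *: y -> PNx = PNy.
  move=> bx by_ tx ty a_gt0 eq_x.
  apply: (@tight_connected_same_bipartition _ _ Pi x) => //.
  by rewrite eq_x; apply: tight_connected_scale.
split=> [x y PNx PNy bx by_ /feasible_tree_tight_connected tx
    /feasible_tree_tight_connected ty neq a a_gt0 eq_x|].
  exact: neq (distinct _ _ _ _ _ bx by_ tx ty a_gt0 eq_x).
have gain i j : i != j -> 1 < Pi i j * Pi j i.
  by move=> ij; rewrite -(Pi_diag i); apply: Pi_lt; rewrite eq_sym.
set A : {set {set 'I_d}} := (~: [set finset.set0; finset.setT])%SET.
have /choice[sol solP] (P : {set 'I_d}) :
    exists y, P \in A -> tight_connected Pi (P, ~: P)%SET y.
  have [PA|] := boolP (P \in A); last by exists 0.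
  have [y ty] := exists_tight_connected Pi_gt0 (bipartition_of_set PA).
  by exists y.
rewrite -card_proper_sets // -/A.
pose f k := open_ray (sol (nth finset.set0 (enum A) k)).
have inA k : (k < #|A|)%N -> nth finset.set0 (enum A) k \in A.
  by move=> kA; rewrite -mem_enum mem_nth // -cardE.
apply/pcard_leP/injfunPex; exists f.
  move=> k /= /inA kA; exists (sol (nth finset.set0 (enum A) k)) => //=.
  by apply: tight_connected_extreme (bipartition_of_set kA) (solP _ kA).
move=> k l /set_mem/= kA /set_mem/= lA eq_ray.
have [a a_gt0 eq_sol] :
    open_ray (sol (nth finset.set0 (enum A) l))
             (sol (nth finset.set0 (enum A) k)).
  by rewrite -/(f l) -eq_ray; exists 1; rewrite ?scale1r.
have [kA' lA'] := (inA _ kA, inA _ lA).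
have [eq_nth _] := distinct _ _ _ _ _ (bipartition_of_set kA')
  (bipartition_of_set lA') (solP _ kA') (solP _ lA') a_gt0 eq_sol.
apply/eqP; rewrite -(nth_uniq finset.set0 _ _ (enum_uniq A)) -?cardE //.
by rewrite eq_nth.
Qed.
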